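(* Let $d=2$. Suppose the $\mathbb{Z}^2$ system is ergodic and almost surely every walk $X_z$, $z\in\mathcal{W}(\omega)$, satisfies: (1) $X_z(\omega,i)\neq X_z(\omega,j)$ for $i\neq j$ (no loops); (2) for each $a\in\mathbb{Z}$ with $a>z\cdot e_1$ there is $k_0$ such that $X_z(\omega,k_0)\cdot e_1=a$ and $X_z(\omega,k)\cdot e_1>a$ for every $k>k_0$. Suppose bi-infinite trajectories exist with positive probability. Then, almost surely, every walk in $\mathcal{W}$ that is not part of a bi-infinite trajectory eventually coalesces with a bi-infinite trajectory; that is, for every $z\in\mathcal{W}(\omega)$ there is $k\in\mathbb{Z}^+$ such that $X_z(\omega,k)$ is a bi-infinite point.
   Context: $\mathbb{Z}^+=\{0,1,2,\dots\}$. $(\Omega,\mathcal{F},\mathbb{P},\{T^z\}_{z\in\mathbb{Z}^d})$ is a measure-preserving $\mathbb{Z}^d$ action on a probability space. $\mathcal{W}(\omega)\subset\mathbb{Z}^d$ is a measurable random set that is translation covariant, $\mathcal{W}(T^z\omega)=\mathcal{W}(\omega)-z$, with $\mathbb{P}(\mathbf{0}\in\mathcal{W})>0$. For $z\in\mathcal{W}(\omega)$, $X_z(\omega,\cdot):\mathbb{Z}^+\to\mathbb{Z}^d$ is a nearest-neighbor path with $X_z(\omega,0)=z$, measurable in $\omega$. Almost surely, for all $z\in\mathcal{W}(\omega)$, $x\in\mathbb{Z}^d$, $k\in\mathbb{Z}^+$, the walks are stationary, $X_z(\omega,k)=x+X_{z-x}(T^x\omega,k)$, and compatible, $X_z(\omega,k+1)=X_{X_z(\omega,1)}(\omega,k)$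 (in particular $X_z(\omega,1)\in\mathcal{W}(\omega)$). A point $z$ is bi-infinite if there is a sequence $(a_n)_{n\ge0}$ in $\mathcal{W}(\omega)$ with $a_0=z$ and $X_{a_n}(\omega,i)=a_{n-i}$ for all $n\ge 1$, $0\le i\le n$. The union $\bigcup_{n}\bigcup_{i\ge0}\{X_{a_n}(\omega,i)\}$ is called a bi-infinite trajectory. Walks coalesce when they meet at a common point (and then stay together by compatibility). *)

(* Defs.v *)
From mathcomp Require Import all_boot all_order all_algebra.
From mathcomp Require Import all_classical all_reals all_analysis.

Set Implicit Arguments.
Unset Strict Implicit.
Unset Printing Implicit Defensive.

Import Order.TTheory GRing.Theory Num.Theory.

Local Open Scope classical_set_scope.
Local Open Scope ring_scope.

(* A measure-preserving action of (Z^n, +) on the probability space (Omega, P). *)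
Definition mp_action (d : measure_display) (Omega : measurableType d)
    (R : realType) (P : probability Omega R) (n : nat)
    (T : 'rV[int]_n -> Omega -> Omega) : Prop :=
  [/\ forall w, T 0 w = w,
      forall x y w, T (x + y) w = T x (T y w),
      forall z, measurable_fun setT (T z)
    & forall z (A : set Omega), measurable A -> P (T z @^-1` A) = P A].

(* Ergodicity of the whole action: only the sets invariant under every T z
   are required to be trivial. *)
Definition ergodic_action (d : measure_display) (Omega : measurableType d)
    (R : realType) (P : probability Omega R) (n : nat)
    (T : 'rV[int]_n -> Omega -> Omega) : Prop :=
  forall A : set Omega, measurable A -> (forall z, T z @^-1` A = A) ->
    P A = 0%E \/ P A = 1%E.

(* Measurability of a random subset of the countable discrete space Z^n. *)
Definition measurable_random_set (d : measure_display)
    (Omega : measurableType d) (n : nat) (W : Omega -> set 'rV[int]_n) : Prop :=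
  forall z, measurable [set w | W w z].

Definition translation_covariant (Omega : Type) (n : nat)
    (T : 'rV[int]_n -> Omega -> Omega) (W : Omega -> set 'rV[int]_n) : Prop :=
  forall z w, W (T z w) = [set y - z | y in W w].

(* A family of walks is a total function X : Omega -> Z^n -> nat -> Z^n whose
   value X w z is meaningful only when z \in W w; none of the predicates below
   constrains it elsewhere.  In particular, measurability in w of X w z k is
   measurability on the event that z belongs to W w. *)
Definition measurable_walks (d : measure_display) (Omega : measurableType d)
    (n : nat) (W : Omega -> set 'rV[int]_n)
    (X : Omega -> 'rV[int]_n -> nat -> 'rV[int]_n) : Prop :=
  forall z k y, measurable [set w | W w z /\ X w z k = y].

Definition nearest_neighbor_path (n : nat) (p : nat -> 'rV[int]_n) : Prop :=
  forall k, \sum_(i < n) `|p k.+1 0 i - p k 0 i| = 1.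

Definition nearest_neighbor_walks (Omega : Type) (n : nat)
    (W : Omega -> set 'rV[int]_n)
    (X : Omega -> 'rV[int]_n -> nat -> 'rV[int]_n) : Prop :=
  forall w z, W w z -> X w z 0%N = z /\ nearest_neighbor_path (X w z).

Definition stationary_at (Omega : Type) (n : nat)
    (T : 'rV[int]_n -> Omega -> Omega) (W : Omega -> set 'rV[int]_n)
    (X : Omega -> 'rV[int]_n -> nat -> 'rV[int]_n) (w : Omega) : Prop :=
  forall z x k, W w z -> X w z k = x + X (T x w) (z - x) k.

Definition compatible_at (Omega : Type) (n : nat)
    (W : Omega -> set 'rV[int]_n)
    (X : Omega -> 'rV[int]_n -> nat -> 'rV[int]_n) (w : Omega) : Prop :=
  forall z, W w z ->
    W w (X w z 1%N) /\ forall k, X w z k.+1 = X w (X w z 1%N) k.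

Definition backward_seq (n : nat) (W : set 'rV[int]_n)
    (X : 'rV[int]_n -> nat -> 'rV[int]_n) (z : 'rV[int]_n)
    (a : nat -> 'rV[int]_n) : Prop :=
  [/\ forall m, W (a m), a 0%N = z &
      forall m i, (1 <= m)%N -> (i <= m)%N -> X (a m) i = a (m - i)%N].

Definition bi_infinite_point (n : nat) (W : set 'rV[int]_n)
    (X : 'rV[int]_n -> nat -> 'rV[int]_n) (z : 'rV[int]_n) : Prop :=
  exists a, backward_seq W X z a.

Definition bi_infinite_trajectory (n : nat) (W : set 'rV[int]_n)
    (X : 'rV[int]_n -> nat -> 'rV[int]_n) (S : set 'rV[int]_n) : Prop :=
  exists z a, backward_seq W X z a /\
    S = \bigcup_m \bigcup_i [set X (a m) i].

Definition no_loops (n : nat) (p : nat -> 'rV[int]_n) : Prop :=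
  forall i j, i <> j -> p i <> p j.

(* The coordinate z . e_1 is z 0 0. *)
Definition eventually_right_of (n : nat) (p : nat -> 'rV[int]_n.+1)
    (a : int) : Prop :=
  exists k0, p k0 0 0 = a /\ forall k, (k0 < k)%N -> a < p k 0 0.

(* Main.v *)
(* If every point z of Z^2 sends mass to at most one point, by a covariant rule,
   then by Borel-Cantelli almost surely no point receives from infinitely many
   points.  Call r a regeneration point if its walk stays strictly to the right
   of r afterwards, and deep if it is moreover reached from arbitrarily far left.

   Existence of deep points.  Every two-sided point has a two-sided preimage; a
   second one would receive from infinitely many points of its own past, so
   two-sided trajectories do not merge.  Such a trajectory has finitely many
   points in each column, and no leftmost one, because all its points could send
   there.  Hence it comes from the far left and its regeneration points are deep.
   By ergodicity deep points exist almost surely, and they have no highest or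
   lowest element in a column.

   Coalescence.  By planarity the map from the regeneration points of a column
   to those of a later column is monotone.  The component of a walk reaching no
   deep point is thus squeezed between two deep walks; if it extended infinitely
   far left, one of the finitely many points of a gap would be deep.  So it has a
   leftmost regeneration point, to which all of the walk could send mass: a
   contradiction. *)
Require Import Defs.
From mathcomp Require Import all_boot all_order all_algebra.
From mathcomp Require Import all_classical all_reals all_analysis.
From mathcomp Require Import zify.
Import Order.TTheory GRing.Theory Num.Theory.
Local Open Scope classical_set_scope.
Local Open Scope ring_scope.

Set Implicit Arguments.
Unset Strict Implicit.
Unset Printing Implicit Defensive.

(** * Planar lattice and compactness *)

Notation site := 'rV[int]_2.

Definition vec (a b : int) : site := \row_(i < 2) (if i == 0 then a else b).

Lemma vec_eta (z : site) : z = vec (z 0 0) (z 0 1).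
Proof.
apply/rowP => i; rewrite mxE; case: eqP => [->//|]; case: i => [[|[|//]] h] ne //.
  by case: ne; apply/val_inj.
by congr (z 0 _); apply/val_inj.
Qed.

Lemma vec0 (a b : int) : (vec a b) 0 0 = a. Proof. by rewrite mxE. Qed.
Lemma vec1 (a b : int) : (vec a b) 0 1 = b. Proof. by rewrite mxE. Qed.

Lemma site_eq (u v : site) : u 0 0 = v 0 0 -> u 0 1 = v 0 1 -> u = v.
Proof. by move=> e0 e1; rewrite (vec_eta u) (vec_eta v) e0 e1. Qed.

Lemma finite_itv_int (a b : int) : finite_set [set k : int | a <= k <= b].
Proof.
apply: (@sub_finite_set _ _ [set a + n%:Z | n in `I_(absz (b - a)).+1]).
  move=> k /= /andP[ak kb]; exists (absz (k - a)) => /=; lia.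
exact/finite_image/finite_II.
Qed.

Lemma finite_column (c a b : int) :
  finite_set [set z : site | z 0 0 = c /\ a <= z 0 1 <= b].
Proof.
apply: (@sub_finite_set _ _ [set vec c k | k in [set k : int | a <= k <= b]]).
  by move=> z /= [zc zab]; exists (z 0 1) => //; rewrite -zc -vec_eta.
exact/finite_image/finite_itv_int.
Qed.

Definition adjacent (u v : site) : Prop :=
  `|v 0 0 - u 0 0| + `|v 0 1 - u 0 1| = 1.

Lemma finite_adjacent (v : site) : finite_set [set u | adjacent u v].
Proof.
apply: (@sub_finite_set _ _ [set vec a b | a in [set k : int | v 0 0 - 1 <= k <= v 0 0 + 1]
   & b in [set k : int | v 0 1 - 1 <= k <= v 0 1 + 1]]).
  move=> u; rewrite /adjacent /= => uv.
  by exists (u 0 0); [lia|exists (u 0 1); [lia|rewrite -vec_eta]].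
apply: finite_image2; exact: finite_itv_int.
Qed.

(** If every point of [D] failed at some level, no point would survive at the largest of these
    levels. *)
Lemma finite_pigeonhole (A : choiceType) (D : set A) (Q : nat -> A -> Prop) :
    finite_set D -> (forall n x, Q n.+1 x -> Q n x) ->
    (forall n, exists2 x, D x & Q n x) ->
  exists2 x, D x & forall n, Q n x.
Proof.
move=> /finite_seqP[s ->] Qmono Qex; apply: contrapT => noQ.
have Qle n m x : (n <= m)%N -> Q m x -> Q n x.
  by move=> /subnK <-; elim: (m - n)%N => //= k ih h; apply: ih; apply: Qmono.
have /choice[N hN] x : exists n, x \in s -> ~ Q n x.
  have [xs|] := boolP (x \in s); last by exists 0%N.
  apply: contrapT => h; apply: noQ; exists x => // n.
  by apply: contrapT => nQ; apply: h; exists n.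
have [x xs] := Qex (\max_(y <- s) N y)%N.
apply: contra_not (hN x xs) => //; apply: Qle.
exact: leq_bigmax_seq.
Qed.

(** Koenig's lemma: having extensions of every length passes from [s] to one of its finitely many
    children, by the pigeonhole principle. *)
Lemma konig (A : choiceType) (Q : seq A -> Prop) :
    (forall s x, Q (rcons s x) -> Q s) ->
    (forall s, finite_set [set x | Q (rcons s x)]) ->
    (forall n, exists2 s, size s = n & Q s) ->
  exists a : nat -> A, forall n, Q (mkseq a n).
Proof.
move=> Qpre Qfin Qex.
pose ext s n := exists2 t, size t = n & Q (s ++ t).
have step s : (forall n, ext s n) -> exists x, forall n, ext (rcons s x) n.
  move=> es.
  have [n x [t tn Qt]|n|x _ hx] := @finite_pigeonhole _ _
     (fun n x => ext (rcons s x) n) (Qfin s).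
  - case/lastP: t tn Qt => // t y; rewrite size_rcons -rcons_cat => -[tn] /Qpre Qt.
    by exists t.
  - have [[//|x t] [tn] Qt] := es n.+1; exists x.
      move: Qt; rewrite -cat_rcons /=.
      elim/last_ind: t {tn} => [|t y ih]; first by rewrite cats0.
      by rewrite -rcons_cat => /Qpre.
    by exists t => //; rewrite cat_rcons.
  - by exists x.
have /choice[g hg] s : exists x, (forall n, ext s n) -> forall n, ext (rcons s x) n.
  have [/step[x hx]|h] := pselect (forall n, ext s n); first by exists x.
  by have [[|x t] // _ _] := Qex 1%N; exists x.
pose S := fix S n := if n is m.+1 then rcons (S m) (g (S m)) else [::].
exists (fun n => g (S n)) => n.
have -> : mkseq (fun n => g (S n)) n = S n.
  by elim: n => // n ih; rewrite mkseqS ih.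
have eS : forall n k, ext (S n) k.
  elim=> [k|m ih]; last exact: hg.
  by have [s sk Qs] := Qex k; exists s.
have [t /size0nil ->] := eS n 0%N.
by rewrite cats0.
Qed.

(** * Winding numbers of lattice paths *)

Definition crossing (x y : int) (u v : site) : int :=
  ((u 0 0 == x) && (v 0 0 == x + 1) && (y < u 0 1))%:Z
  - ((u 0 0 == x + 1) && (v 0 0 == x) && (y < u 0 1))%:Z.

(* The signed number of times the path crosses the upward vertical half line
   starting at (x + 1/2, y + 1/2). *)
Definition winding (p : nat -> site) (m n : nat) (x y : int) : int :=
  \sum_(m <= k < n) crossing x y (p k) (p k.+1).

(** The two half lines differ only across the edge at height [y + 1], whose left end is the avoided
    site. *)
Lemma crossing_vertical (x y : int) (u v : site) : adjacent u v ->
  u <> vec x (y + 1) -> v <> vec x (y + 1) ->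
  crossing x y u v = crossing x (y + 1) u v.
Proof.
move=> + une vne; have := une; have := vne.
rewrite (vec_eta u) (vec_eta v) /crossing /adjacent !vec0 !vec1.
move: (u 0 0) (u 0 1) (v 0 0) (v 0 1) => a b c e {une vne} vne une.
have : ~ (a = x /\ b = y + 1) by move=> [h1 h2]; apply: une; rewrite h1 h2.
have : ~ (c = x /\ e = y + 1) by move=> [h1 h2]; apply: vne; rewrite h1 h2.
case: (a =P x) => [->|?]; case: (c =P x) => [->|?]; rewrite ?andbF /=; lia.
Qed.

(** The two half lines bound the part of column [x + 1] above [y]; otherwise this part can be
    entered or left only through its foot, the avoided site. *)
Lemma crossing_horizontal (x y : int) (u v : site) : adjacent u v ->
  u <> vec (x + 1) y -> v <> vec (x + 1) y ->
  crossing x y u v - crossing (x + 1) y u v =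
  ((v 0 0 == x + 1) && (y < v 0 1))%:Z - ((u 0 0 == x + 1) && (y < u 0 1))%:Z.
Proof.
move=> + une vne; have := une; have := vne.
rewrite (vec_eta u) (vec_eta v) /crossing /adjacent !vec0 !vec1.
move: (u 0 0) (u 0 1) (v 0 0) (v 0 1) => a b c e {une vne} vne une.
have : ~ (a = x + 1 /\ b = y) by move=> [h1 h2]; apply: une; rewrite h1 h2.
have : ~ (c = x + 1 /\ e = y) by move=> [h1 h2]; apply: vne; rewrite h1 h2.
case: (a =P x + 1) => [->|ax1]; case: (c =P x + 1) => [->|cx1];
  case: (_ =P x) => [?|?]; case: (_ =P x + 1 + 1) => [?|?];
  rewrite ?andbF /=; lia.
Qed.

Lemma winding_vertical (p : nat -> site) (n : nat) (x y : int) :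
    (forall k, (k < n)%N -> adjacent (p k) (p k.+1)) ->
    (forall k, (k <= n)%N -> p k <> vec x (y + 1)) ->
  winding p 0 n x y = winding p 0 n x (y + 1).
Proof.
move=> adj av; apply: eq_big_nat => k /= kn.
by apply: crossing_vertical; [apply: adj|apply: av; lia|apply: av].
Qed.

(* The number of steps of the path into the half line above (x + 1, y) equals
   the number of steps out of it, because neither end of the path lies on it. *)
Lemma winding_horizontal (p : nat -> site) (n : nat) (x y : int) :
    (forall k, (k < n)%N -> adjacent (p k) (p k.+1)) ->
    (forall k, (k <= n)%N -> p k <> vec (x + 1) y) ->
    p 0%N 0 0 != x + 1 -> p n 0 0 != x + 1 ->
  winding p 0 n x y = winding p 0 n (x + 1) y.
Proof.
move=> adj av /negbTE p0 /negbTE pn; apply/eqP; rewrite -subr_eq0 /winding -sumrB.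
rewrite (telescope_sumr_eq (fun k => ((p k 0 0 == x + 1) && (y < p k 0 1))%:Z)) //.
  by rewrite p0 pn.
move=> k /= kn.
by apply: crossing_horizontal; [apply: adj|apply: av; lia|apply: av].
Qed.

(** The base point moves along [q] one edge at a time. The bounds [a] and [b] keep both ends of [p]
    off the right-hand column of each horizontal move. *)
Lemma winding_path (p q : nat -> site) (m n : nat) (a b : int) :
    (forall k, (k < n)%N -> adjacent (p k) (p k.+1)) ->
    (forall k, (k < m)%N -> adjacent (q k) (q k.+1)) ->
    (forall k, (k <= m)%N -> a <= q k 0 0 <= b) ->
    p 0%N 0 0 <= a -> p n 0 0 <= a \/ b < p n 0 0 ->
    (forall k l, (k <= n)%N -> (l <= m)%N -> p k <> q l) ->
  winding p 0 n (q 0%N 0 0) (q 0%N 0 1) = winding p 0 n (q m 0 0) (q m 0 1).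
Proof.
move=> adjp; elim: m => // m ih adjq qab p0 pn pq.
rewrite ih //; first last.
- by move=> k l kn lm; apply: pq => //; lia.
- by move=> k km; apply: qab; lia.
- by move=> k km; apply: adjq; lia.
have := adjq m (ltnSn m); have := qab m (leqnSn m); have := qab m.+1 (leqnn _).
have pq0 k : (k <= n)%N -> p k <> vec (q m 0 0) (q m 0 1).
  by move=> kn; rewrite -vec_eta; apply: pq.
have pq1 k : (k <= n)%N -> p k <> vec (q m.+1 0 0) (q m.+1 0 1).
  by move=> kn; rewrite -vec_eta; apply: pq.
rewrite /adjacent; move: (q m 0 0) (q m 0 1) (q m.+1 0 0) (q m.+1 0 1) pq0 pq1.
move=> x y x' y' pq0 pq1 xb x'b adj.
have : [\/ x' = x /\ y' = y + 1, x' = x /\ y = y' + 1,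
   x' = x + 1 /\ y' = y | x = x' + 1 /\ y' = y].
  have : (x' = x /\ y' = y + 1) \/ (x' = x /\ y = y' + 1) \/
   (x' = x + 1 /\ y' = y) \/ (x = x' + 1 /\ y' = y) by lia.
  by move=> [|[|[]]] ?; [constructor 1|constructor 2|constructor 3|constructor 4].
case=> [] [e e']; subst.
- exact: winding_vertical.
- by rewrite -winding_vertical.
- by apply: winding_horizontal => //; lia.
- by rewrite -winding_horizontal //; lia.
Qed.

(** * Regeneration points and planarity *)

(** The planar argument concerns one fixed configuration; [iter k f z] stands for position [k] of
    the walk from [z]. *)
Record walk_system (W : set site) (f : site -> site) : Prop := WalkSystem {
  walk_stay : forall z, W z -> W (f z);
  walk_adjacent : forall z, W z -> adjacent z (f z);
  walk_no_loops : forall z i j, W z -> iter i f z = iter j f z -> i = j;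
  walk_right : forall z a, W z -> z 0 0 < a ->
    eventually_right_of (fun k => iter k f z) a }.

Definition reaches (f : site -> site) (u v : site) : Prop :=
  exists k, iter k f u = v.

Definition regeneration (W : set site) (f : site -> site) (r : site) : Prop :=
  W r /\ forall k, (0 < k)%N -> r 0 0 < (iter k f r) 0 0.

Section WalkSystem.
Variables (W : set site) (f : site -> site).
Hypothesis ws : walk_system W f.

Lemma walk_stay_iter z k : W z -> W (iter k f z).
Proof. by move=> Wz; elim: k => //= k; apply: (walk_stay ws). Qed.

Lemma walk_adjacent_iter z k : W z -> adjacent (iter k f z) (iter k.+1 f z).
Proof. by move=> Wz; apply/(walk_adjacent ws)/walk_stay_iter. Qed.

Lemma reaches_refl z : reaches f z z. Proof. by exists 0%N. Qed.

Lemma reaches_iter z k : reaches f z (iter k f z). Proof. by exists k. Qed.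

Lemma reaches_trans u v z : reaches f u v -> reaches f v z -> reaches f u z.
Proof. by move=> [j <-] [k <-]; exists (k + j)%N; rewrite iterD. Qed.

Lemma reaches_comparable u v v' : reaches f u v -> reaches f u v' ->
  reaches f v v' \/ reaches f v' v.
Proof.
move=> [j <-] [k <-]; have [jk|/ltnW kj] := leqP j k; [left|right].
  by exists (k - j)%N; rewrite -iterD subnK.
by exists (j - k)%N; rewrite -iterD subnK.
Qed.

(** The last visit to column [a] is a regeneration point. *)
Lemma regeneration_ahead z a : W z -> z 0 0 < a ->
  exists r, [/\ regeneration W f r, r 0 0 = a & reaches f z r].
Proof.
move=> Wz za; have [k [ka kgt]] := walk_right ws Wz za.
exists (iter k f z); split=> //; last exact: reaches_iter.
split; first exact: walk_stay_iter.
by move=> j j0; rewrite ka -iterD; apply: kgt; lia.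
Qed.

Lemma regeneration_ahead_le z a : regeneration W f z -> z 0 0 <= a ->
  exists r, [/\ regeneration W f r, r 0 0 = a & reaches f z r].
Proof.
move=> rz; rewrite le_eqVlt => /predU1P[za|za]; last first.
  by apply: regeneration_ahead => //; case: rz.
by exists z; split=> //; apply: reaches_refl.
Qed.

Lemma reaches_regeneration r v : regeneration W f r -> reaches f r v ->
  v = r \/ r 0 0 < v 0 0.
Proof. by move=> [Wr hr] [[|k] <-]; [left|right; apply: hr]. Qed.

Lemma regeneration_before u r v : regeneration W f r ->
  reaches f u r -> reaches f u v -> v 0 0 <= r 0 0 -> reaches f v r.
Proof.
move=> hr ur uv vr; case: (reaches_comparable ur uv) => // rv.
case: (reaches_regeneration hr rv) => [->|]; [exact: reaches_refl|lia].
Qed.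

Lemma regeneration_unique u r r' : regeneration W f r -> regeneration W f r' ->
  reaches f u r -> reaches f u r' -> r 0 0 = r' 0 0 -> r = r'.
Proof.
move=> hr hr' ur ur' e.
have rr' : reaches f r r' by apply: (regeneration_before hr' ur' ur); rewrite e.
by case: (reaches_regeneration hr rr') => [->//|]; rewrite e ltxx.
Qed.

Lemma column_bounded (p : nat -> site) n :
  exists b : int, forall k, (k <= n)%N -> p k 0 0 <= b.
Proof.
elim: n => [|n [b hb]]; first by exists (p 0%N 0 0) => k; rewrite leqn0 => /eqP ->.
exists (Num.max b (p n.+1 0 0)) => k; rewrite leq_eqVlt => /predU1P[->|kn].
  by rewrite le_max lexx orbT.
by rewrite le_max hb.
Qed.

Lemma eventually_beyond z (b : int) : W z ->
  exists K, forall k, (K <= k)%N -> b < (iter k f z) 0 0.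
Proof.
move=> Wz.
have [|k [_ hk]] := @walk_right _ _ ws z (Num.max b (z 0 0) + 1) Wz; first by lia.
by exists k.+1 => j /hk; lia.
Qed.

(* Past its first step, the walk from a regeneration point never uses an edge
   between that point's column and the next one. *)
Lemma winding_regeneration r (y : int) (n : nat) : regeneration W f r ->
  winding (fun k => iter k f r) 0 n.+1 (r 0 0) y = (y < r 0 1)%R%:Z.
Proof.
move=> [Wr hr]; rewrite /winding big_ltn // big1_seq ?addr0; last first.
  move=> k; rewrite mem_index_iota => /andP[_ /andP[k0 _]].
  have := hr k k0; have := hr k.+1 isT.
  rewrite /crossing; move: (iter k f r) (iter k.+1 f r) => u v.
  by move=> h1 h2; rewrite (gt_eqF h1) (gt_eqF h2) andbF.
have := hr 1%N isT; have := walk_adjacent ws Wr.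
rewrite /crossing /adjacent /=; move: (f r) => v; lia.
Qed.

Lemma winding_cat (p : nat -> site) (n m : nat) (x y : int) :
  winding p 0 (n + m) x y =
  winding p 0 n x y + winding (fun k => p (n + k)%N) 0 m x y.
Proof.
rewrite /winding (@big_cat_nat _ _ _ n) //=; last exact: leq_addr.
by congr (_ + _); rewrite -{1}[n]add0n big_addn addKn; apply: eq_bigr => k _;
  rewrite addnC addnS.
Qed.

(* Suppose that [u'] is below [t'].  The walk from [u] up to [u'] avoids the
   whole walk from [t]; the winding number of the latter vanishes at [u], hence
   at [u'].  But it is 1 at [u']: the part of the walk after [t'] contributes 1,
   and the arc from [t] to [t'] contributes 0 because the walk from [u'] escapes
   to the right of this arc without meeting it. *)
Lemma regeneration_monotone t u t' u' :
    regeneration W f t -> regeneration W f u -> t 0 0 = u 0 0 -> t 0 1 <= u 0 1 ->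
    regeneration W f t' -> regeneration W f u' -> t' 0 0 = u' 0 0 ->
    reaches f t t' -> reaches f u u' ->
  t' 0 1 <= u' 0 1.
Proof.
move=> ht hu tu0 tu1 ht' hu' tu0' tt' uu'.
have [//|ut1'] := leP; exfalso.
have nut' : ~ reaches f u t'.
  move=> ut'; have e := regeneration_unique ht' hu' ut' uu' tu0'.
  by move: ut1'; rewrite e ltxx.
have ntu' : ~ reaches f t u'.
  move=> tu'; have e := regeneration_unique ht' hu' tt' tu' tu0'.
  by move: ut1'; rewrite e ltxx.
have [Wt _] := ht; have [Wu hu1] := hu; have [Wu' hu1'] := hu'.
have [[j tj] [l ul]] := (tt', uu').
have ad p : W p -> forall n k, (k < n)%N -> adjacent (iter k f p) (iter k.+1 f p).
  by move=> Wp n k _; apply: walk_adjacent_iter.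
have [b hb] := column_bounded (fun k => iter k f u) l.
have [K0 hK0] := eventually_beyond b Wt.
(* The walk from [t] is followed until it is to the right of the whole arc from [u] to [u'], as
   [winding_path] requires of its end; the successor keeps the part after [t'] nonempty. *)
pose K := K0.+1; have Kb : b < (iter (j + K) f t) 0 0 by apply: hK0; lia.
have : winding (fun k => iter k f t) 0 (j + K) (u 0 0) (u 0 1) =
       winding (fun k => iter k f t) 0 (j + K) (u' 0 0) (u' 0 1).
  rewrite -ul; apply: (@winding_path _ (fun k => iter k f u) l _ (u 0 0) b).
  - exact: ad.
  - exact: ad.
  - move=> k kl; rewrite hb // andbT; case: k {kl} => // k.
    by apply/ltW/hu1.
  - by rewrite tu0.
  - by right.
  - move=> i k _ kl e; apply: ntu'; apply: (@reaches_trans _ (iter k f u)).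
      by rewrite -e; apply: reaches_iter.
    by exists (l - k)%N; rewrite -iterD subnK.
rewrite -{1}tu0 addnS winding_regeneration // -addnS.
have -> : (u 0 1 < t 0 1) = false by lia.
rewrite winding_cat.
have -> : (fun k => iter (j + k) f t) = (fun k => iter k f t').
  by apply/funext => k; rewrite addnC iterD tj.
rewrite -[in X in _ + X]tu0' winding_regeneration // ut1'.
(* After [m] steps the walk from [u'] is to the right of the whole arc from [t] to [t'], so there no
   edge of the arc is counted. *)
have [b' hb'] := column_bounded (fun k => iter k f t) j.
have [m hm] := eventually_beyond b' Wu'.
have [b2 hb2] := column_bounded (fun k => iter k f u') m.
suff -> : winding (fun k => iter k f t) 0 j (u' 0 0) (u' 0 1) = 0 by [].
have wp := @winding_path (fun k => iter k f t) (fun k => iter k f u') m j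
  (u' 0 0) b2 (ad _ Wt _) (ad _ Wu' _).
rewrite {}wp /= ?tj.
- rewrite [winding _ _ _ _ _]big1_seq // => k; rewrite mem_index_iota.
  move=> /andP[_ /andP[_ kj]]; rewrite /crossing.
  have := hm m (leqnn m); have := hb' k (ltnW kj); have := hb' _ kj => /=.
  by move: (f (iter k f t)) (iter k f t) (iter m f u') => v w z; lia.
- move=> k km; rewrite hb2 // andbT; case: k {km} => // k.
  by apply/ltW/hu1'.
- rewrite -tu0'; case: (reaches_regeneration ht tt') => [->|/ltW] //.
- by left; rewrite tu0'.
- move=> i k ij _ e; apply: nut'; apply: (reaches_trans uu').
  apply: (@reaches_trans _ (iter k f u')); first exact: reaches_iter.
  by rewrite -e; exists (j - i)%N; rewrite -iterD subnK.
Qed.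

End WalkSystem.

(** * Transports and their consequences *)

Definition joined (f : site -> site) (u v : site) : Prop :=
  exists j k, iter j f u = iter k f v.

(** Only countable quantifiers occur here, which makes the event measurable; by compactness it
    amounts to being a bi-infinite point. *)
Definition two_sided (W : set site) (f : site -> site) (z : site) : Prop :=
  forall n, exists2 u, W u & iter n f u = z.

Definition deep (W : set site) (f : site -> site) (r : site) : Prop :=
  regeneration W f r /\
  forall b : int, exists u, [/\ W u, u 0 0 < b & reaches f u r].

Definition stray (W : set site) (f : site -> site) (z : site) : Prop :=
  W z /\ forall s, deep W f s -> ~ reaches f z s.

(* The two-sided points that are not the preferred two-sided preimage of their
   image; the preference depends only on the direction of the last step. *)
Definition secondary (W : set site) (f : site -> site) (z : site) : Prop :=
  two_sided W f z /\ exists z', [/\ two_sided W f z', f z' = f z &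
    (pickle (z' - f z)%R < pickle (z - f z)%R)%N].

Definition lexi_le (u v : site) : Prop :=
  u 0 0 < v 0 0 \/ u 0 0 = v 0 0 /\ u 0 1 <= v 0 1.

(* In the four transports below [z] sends mass to at most one point, so that
   almost surely no point receives from infinitely many [z]. *)
Definition transport_ahead (W : set site) (f : site -> site) (j : int)
    (z r : site) : Prop :=
  [/\ regeneration W f r, W z, reaches f z r & r 0 0 = z 0 0 + j].

Definition transport_secondary (W : set site) (f : site -> site)
    (z n : site) : Prop :=
  two_sided W f z /\ exists k, [/\ iter k f z = n, secondary W f n &
    forall i, (i < k)%N -> ~ secondary W f (iter i f z)].

Definition transport_leftmost (B E : set site) (f : site -> site)
    (z p : site) : Prop :=
  [/\ B z, E p, joined f z p & forall u, E u -> joined f z u -> lexi_le p u].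

(** All sites of a column send, whether in [W] or not, so that an extreme deep point would receive
    infinite mass. The sign of [e] selects the highest or the lowest one. *)
Definition transport_extreme (W : set site) (f : site -> site) (e : int)
    (z s : site) : Prop :=
  [/\ deep W f s, s 0 0 = z 0 0 & forall u, deep W f u -> u 0 0 = z 0 0 ->
    e * u 0 1 <= e * s 0 1].

Lemma injective_infinite (A : choiceType) (g : nat -> A) (D : set A) :
  injective g -> (forall n, D (g n)) -> ~ finite_set D.
Proof.
move=> gi gD /(finite_preimage (in2W gi)).
have -> : g @^-1` D = setT by apply/seteqP; split=> // n _; apply: gD.
exact: infinite_nat.
Qed.

Lemma int_min (C : set int) (b : int) : C !=set0 -> (forall k, C k -> b <= k) ->
  exists2 m, C m & forall k, C k -> m <= k.
Proof.
move=> [k0 Ck0] Cb.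
have ex : exists n : nat, `[< C (b + n%:Z) >].
  exists (absz (k0 - b)); apply/asboolP.
  by have -> : b + absz (k0 - b) = k0 by have := Cb _ Ck0; lia.
case: (ex_minnP ex) => n /asboolP Cn nmin; exists (b + n%:Z) => // k Ck.
have bk := Cb _ Ck.
suff : (n <= absz (k - b))%N by lia.
apply: nmin; apply/asboolP.
by have -> : b + absz (k - b) = k by lia.
Qed.

Lemma finite_row_bounded (D : set site) : finite_set D ->
  exists b : int, forall z, D z -> b <= z 0 1.
Proof.
move=> /finite_seqP[s ->]; elim: s => [|x s [b hb]]; first by exists 0.
exists (Num.min b (x 0 1)) => z /=; rewrite inE => /predU1P[->|/hb]; lia.
Qed.

Lemma lexi_min (C : set site) (u : site) (b : int) : C u ->
    (forall v, C v -> b <= v 0 0) ->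
    (forall c : int, c <= u 0 0 -> exists b' : int,
      forall v, C v -> v 0 0 = c -> b' <= v 0 1) ->
  exists2 p, C p & forall v, C v -> lexi_le p v.
Proof.
move=> Cu Cb Crow.
have [||m [v Cv vm] mmin] := @int_min [set k | exists2 v, C v & v 0 0 = k] b.
- by exists (u 0 0), u.
- by move=> k [v Cv <-]; apply: Cb.
have [b' hb'] : exists b' : int, forall v, C v -> v 0 0 = m -> b' <= v 0 1.
  by apply: Crow; apply: mmin; exists u.
have [||l [p [Cp pm] pl] lmin] :=
    @int_min [set k | exists2 v, C v /\ v 0 0 = m & v 0 1 = k] b'.
- by exists (v 0 1), v.
- by move=> k [x [Cx xm] <-]; apply: hb'.
exists p => // x Cx; rewrite /lexi_le pm pl.
have : m <= x 0 0 by apply: mmin; exists x.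
rewrite le_eqVlt => /predU1P[e|]; last by left.
by right; split=> //; apply: lmin; exists x.
Qed.

Lemma lexi_le_anti u v : lexi_le u v -> lexi_le v u -> u = v.
Proof. by rewrite /lexi_le => h1 h2; apply: site_eq; lia. Qed.

Lemma joined_step f u v : joined f (f u) v <-> joined f u v.
Proof.
split=> [[j [k e]]|[j [k e]]].
  by exists j.+1, k; rewrite iterSr.
by exists j, k.+1; rewrite -iterSr !iterS e.
Qed.

Lemma joined_reaches f u v w : joined f u v -> reaches f v w -> joined f u w.
Proof.
move=> [j [k e]] [i <-]; exists (i + j)%N, k.
by rewrite iterD e -!iterD addnC.
Qed.

Lemma joined_refl f u : joined f u u. Proof. by exists 0%N, 0%N. Qed.

Section Transports.
Variables (W : set site) (f : site -> site).
Hypothesis ws : walk_system W f.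

Lemma two_sided_stay z : two_sided W f z -> two_sided W f (f z).
Proof.
move=> hz n; have [u Wu <-] := hz n.
by exists (f u); [apply: (walk_stay ws)|rewrite -iterSr].
Qed.

Lemma two_sided_iter z k : two_sided W f z -> two_sided W f (iter k f z).
Proof. by move=> hz; elim: k => //= k; apply: two_sided_stay. Qed.

Lemma two_sided_mem z : two_sided W f z -> W z.
Proof. by move=> /(_ 0%N)[u Wu <-]. Qed.

(** By the pigeonhole principle, one of the finitely many neighbours mapped to [z] has ancestors of
    every order. *)
Lemma two_sided_preimage z : two_sided W f z ->
  exists2 y, two_sided W f y & f y = z.
Proof.
move=> hz.
have [| | |y [_ fy] hy] := @finite_pigeonhole _ [set y | adjacent y z /\ f y = z]
  (fun n y => exists2 u, W u & iter n f u = y).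
- by apply: (sub_finite_set _ (finite_adjacent z)) => y [].
- by move=> n y [u Wu <-]; exists (f u); [apply: (walk_stay ws)|rewrite -iterSr].
- move=> n; have [u Wu <-] := hz n.+1; exists (iter n f u); last by exists u.
  by split=> //; apply: (walk_adjacent_iter ws n).
- by exists y.
Qed.

Lemma transport_ahead_functional j z r r' :
  transport_ahead W f j z r -> transport_ahead W f j z r' -> r = r'.
Proof.
move=> [hr _ zr rj] [hr' _ zr' r'j].
by apply: (regeneration_unique hr hr' zr zr'); rewrite rj.
Qed.

Lemma transport_secondary_functional z n n' :
  transport_secondary W f z n -> transport_secondary W f z n' -> n = n'.
Proof.
move=> [_ [k [kn hn kmin]]] [_ [k' [kn' hn' kmin']]].
have [kk'|k'k|e] := ltngtP k k'; last by rewrite -kn -kn' e.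
- by case: (kmin' k kk'); rewrite kn.
- by case: (kmin k' k'k); rewrite kn'.
Qed.

Lemma transport_leftmost_functional B E z p p' :
  transport_leftmost B E f z p -> transport_leftmost B E f z p' -> p = p'.
Proof.
move=> [_ Ep zp pmin] [_ Ep' zp' pmin'].
by apply: lexi_le_anti; [apply: pmin|apply: pmin'].
Qed.

Lemma transport_extreme_functional e z s s' : e != 0 ->
  transport_extreme W f e z s -> transport_extreme W f e z s' -> s = s'.
Proof.
move=> e0 [hs sz smax] [hs' sz' smax']; apply: site_eq; first by rewrite sz.
apply: (mulfI e0); apply/eqP.
by rewrite eq_le smax' // smax.
Qed.

(* Following preferred preimages backwards from a secondary point yields
   infinitely many points that all send to it. *)
Lemma two_sided_injective z z' :
    (forall n, finite_set [set b | transport_secondary W f b n]) ->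
    two_sided W f z -> two_sided W f z' -> f z = f z' ->
  z = z'.
Proof.
move=> fin hz hz' e.
suff nosec n : ~ secondary W f n.
  apply: contrapT => zz'.
  have : pickle (z - f z) <> pickle (z' - f z').
    by move=> /(pcan_inj pickleK); rewrite e => /addIr.
  case: (ltngtP (pickle (z - f z)) (pickle (z' - f z'))) => // lt _.
    by apply: (nosec z'); split=> //; exists z; rewrite -[in z - _]e.
  by apply: (nosec z); split=> //; exists z'; rewrite [in z' - _]e.
move=> hn.
(* [g] picks the two-sided preimage of least code, which is therefore not secondary. *)
have /choice[g hg] y : exists x, two_sided W f y ->
    [/\ two_sided W f x, f x = y & ~ secondary W f x].
  have [hy|] := pselect (two_sided W f y); last by exists 0.
  have ex : exists k, `[< exists2 x, two_sided W f x /\ f x = y & pickle (x - y) = k >].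
    have [x hx fx] := two_sided_preimage hy; exists (pickle (x - y)).
    by apply/asboolP; exists x.
  case: (ex_minnP ex) => k /asboolP[x [hx fx] xk] kmin; exists x => _; split=> //.
  move=> [_ [x' [hx' fx' lt]]]; move: lt; rewrite fx xk ltnNge => /negP; apply.
  by apply: kmin; apply/asboolP; exists x' => //; split=> //; rewrite fx'.
have hb i : two_sided W f (iter i g n).
  by elim: i => [|i ih]; [case: hn|case: (hg _ ih)].
have fg i k : iter k f (iter (k + i) g n) = iter i g n.
  elim: k => // k ih; rewrite iterSr addSn iterS.
  by have [_ -> _] := hg _ (hb (k + i)%N).
have bn i : iter i f (iter i g n) = n by rewrite -{2}[i]addn0 fg.
apply: (@injective_infinite _ (fun i => iter i g n) _ _ _ (fin n)).
  move=> i j /= e'; have Wb := two_sided_mem (hb i).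
  by apply: (walk_no_loops ws Wb); rewrite bn e' bn.
(* Before its step [i] the walk from [iter i g n] meets only points chosen by [g], so [n] is the
   first secondary point on it. *)
move=> i; split=> //; exists i; split=> // j ji.
rewrite -(subnKC (ltnW ji)) fg; have [k ->] : exists k, (i - j = k.+1)%N.
  by exists (i - j).-1; rewrite prednK // subn_gt0.
by rewrite iterS; case: (hg _ (hb k)).
Qed.

(** All points of the walk from [z] lie in [B] and in the component of [z], so they all send to the
    same [p]; without loops they are infinitely many. *)
Lemma no_leftmost B E :
    (forall z, B z -> W z /\ B (f z)) ->
    (forall p, finite_set [set z | transport_leftmost B E f z p]) ->
  forall z p, ~ transport_leftmost B E f z p.
Proof.
move=> Bf fin z p [Bz Ep zp pmin].
have Bk k : B (iter k f z) by elim: k => //= k /Bf[].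
have jk k u : joined f (iter k f z) u <-> joined f z u.
  by elim: k => //= k <-; rewrite joined_step.
apply: (@injective_infinite _ (fun k => iter k f z) _ _ _ (fin p)).
  by move=> i j; apply: (walk_no_loops ws); case: (Bf _ Bz).
move=> k; split=> //; first exact/jk.
by move=> u Eu /jk; apply: pmin.
Qed.

Lemma joined_two_sided u v :
    (forall z z', two_sided W f z -> two_sided W f z' -> f z = f z' -> z = z') ->
    two_sided W f u -> two_sided W f v -> joined f u v ->
  reaches f u v \/ reaches f v u.
Proof.
move=> finj hu hv [j [k e]].
have cancel i x y : two_sided W f x -> two_sided W f y ->
    iter i f x = iter i f y -> x = y.
  move=> hx hy; elim: i => //= i ih /finj h; apply/ih/h; exact: two_sided_iter.
case: (leqP j k) => [jk|/ltnW kj]; [right; exists (k - j)%N|left; exists (j - k)%N].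
  by apply/esym/(cancel j) => //; [exact: two_sided_iter|rewrite -iterD subnKC].
by apply: (cancel k) => //; [exact: two_sided_iter|rewrite -iterD subnKC].
Qed.

(** If nothing to the left of [b] led to [r], the two-sided points of its component would be bounded
    on the left, and bounded below in each column up to that of [r]. A leftmost one would exist,
    which [no_leftmost] forbids. *)
Lemma two_sided_deep r :
    (forall j r', finite_set [set z | transport_ahead W f j z r']) ->
    (forall n, finite_set [set b | transport_secondary W f b n]) ->
    (forall p, finite_set
       [set z | transport_leftmost (two_sided W f) (two_sided W f) f z p]) ->
    two_sided W f r -> regeneration W f r ->
  deep W f r.
Proof.
move=> fin_ahead fin_sec fin_left hr rr; split=> // b.
apply: contrapT => nb.
have cmp u : two_sided W f u -> joined f r u -> reaches f r u \/ reaches f u r.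
  move=> hu; apply: joined_two_sided => // z z'; exact: two_sided_injective.
have [|v [hv rv]|c cr|p [hp rp] pmin] :=
    @lexi_min [set u | two_sided W f u /\ joined f r u] r (Num.min b (r 0 0)).
- by split=> //; apply: joined_refl.
- rewrite ge_min; apply/orP; case: (cmp v hv rv) => [rv'|vr].
    by right; case: (reaches_regeneration rr rv') => [->|/ltW].
  left; rewrite leNgt; apply/negP => vb; apply: nb; exists v; split=> //.
  exact: two_sided_mem.
(* All these points of column [c] reach the regeneration point [r'] one column past [r], so they
   send to it at offset [r' 0 0 - c] and are finite in number. *)
- have [|r' [hr' rc rr']] := @regeneration_ahead _ _ ws r (r 0 0 + 1) (proj1 rr).
    by lia.
  have [b' hb'] := finite_row_bounded (fin_ahead (r' 0 0 - c) r').
  exists b' => v [hv rv] vc; apply: hb'; split=> //; first exact: two_sided_mem.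
    case: (cmp v hv rv) => [rv'|vr]; last exact: reaches_trans rr'.
    by apply: (regeneration_before hr' rr' rv'); lia.
  by rewrite vc addrC subrK.
- apply: (no_leftmost _ fin_left (z := r) (p := p)).
    by move=> z hz; split; [exact: two_sided_mem|exact: two_sided_stay].
  by split=> // u hu ru; apply: pmin.
Qed.

(** A step moves at most one column, so a walk starting more than [n] columns to the left takes at
    least [n] steps to reach [s]. *)
Lemma deep_two_sided s : deep W f s -> two_sided W f s.
Proof.
move=> [_ hs] n; have [u [Wu us [k uk]]] := hs (s 0 0 - n%:Z).
have dist m : (iter m f u) 0 0 <= u 0 0 + m%:Z.
  elim: m => [|m ih]; first by rewrite addr0.
  have := walk_adjacent_iter ws m Wu; rewrite /adjacent; lia.
have nk : (n <= k)%N by have := dist k; rewrite uk; lia.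
exists (iter (k - n) f u); first exact: (walk_stay_iter ws).
by rewrite -iterD subnKC.
Qed.

Lemma deep_ahead s s' : deep W f s -> regeneration W f s' -> reaches f s s' ->
  deep W f s'.
Proof.
move=> [_ hs] hs' ss'; split=> // b; have [u [Wu ub us]] := hs b.
by exists u; split=> //; apply: reaches_trans ss'.
Qed.

(** A regeneration point past the meeting with the walk from [s] would itself be deep. *)
Lemma stray_deep r s : stray W f r -> deep W f s -> ~ joined f r s.
Proof.
move=> [Wr hr] hs [j [k e]]; have Wv := walk_stay_iter ws k (proj1 (proj1 hs)).
have [|v [hv _ vv]] := regeneration_ahead ws Wv (a := (iter k f s) 0 0 + 1).
  lia.
apply: (hr v); last by apply: reaches_trans vv; rewrite -e; apply: reaches_iter.
by apply: (deep_ahead hs hv); apply: reaches_trans vv; apply: reaches_iter.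
Qed.

(** In a column [N] past the meeting point, the walks from [r] and [t] share the regeneration point
    [v], and those from [s] and [s'] share [w]. Opposite orders in the two columns would force
    [v = w] by monotonicity, joining [r] to [s]. *)
Lemma joined_regeneration_order r t s s' :
    regeneration W f r -> regeneration W f t -> joined f r t -> t 0 0 <= r 0 0 ->
    regeneration W f s -> regeneration W f s' -> reaches f s' s ->
    s 0 0 = r 0 0 -> s' 0 0 = t 0 0 -> ~ joined f r s ->
  (s 0 1 <= r 0 1 -> s' 0 1 < t 0 1) /\ (r 0 1 <= s 0 1 -> t 0 1 < s' 0 1).
Proof.
move=> hr ht [j [k e]] tr hs hs' s's sr s't nrs.
pose N := Num.max (r 0 0) ((iter k f t) 0 0) + 1.
have [|v [hv vN tv]] := regeneration_ahead ws (walk_stay_iter ws k (proj1 ht)) (a := N).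
  by rewrite /N; lia.
have [|w [hw wN sw]] := regeneration_ahead ws (proj1 hs) (a := N); first by rewrite /N; lia.
have tv' : reaches f t v by apply: reaches_trans tv; apply: reaches_iter.
have rv' : reaches f r v by apply: reaches_trans tv; rewrite -e; apply: reaches_iter.
have s'w : reaches f s' w by apply: reaches_trans sw.
have vw : v 0 0 = w 0 0 by rewrite vN wN.
have ne : v 0 1 <> w 0 1.
  move=> e1; apply: nrs; have [[i ri] [i' si']] := (rv', sw).
  by exists i, i'; rewrite ri si'; apply: site_eq.
split=> h; rewrite ltNge; apply/negP => h'; apply: ne; apply/eqP; rewrite eq_le.
  rewrite (regeneration_monotone ws ht hs' _ h' hv hw) //.
  exact: (regeneration_monotone ws hs hr _ h hw hv).
rewrite (regeneration_monotone ws hr hs _ h hv hw) //.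
exact: (regeneration_monotone ws hs' ht _ h' hw hv).
Qed.

(** If the heights were bounded in the direction of [e], an extreme deep point would exist and
    receive from every site of the column. *)
Lemma deep_unbounded s e (m : int) : e != 0 ->
    (forall y, finite_set [set z | transport_extreme W f e z y]) ->
    deep W f s ->
  exists s', [/\ deep W f s', s' 0 0 = s 0 0 & m < e * s' 0 1].
Proof.
move=> e0 fin hs; apply: contrapT => h.
have [||l [y [hy ys] yl] ymax] := @int_min
  [set k | exists2 s', deep W f s' /\ s' 0 0 = s 0 0 & k = - (e * s' 0 1)] (- m).
- by exists (- (e * s 0 1)), s.
- move=> k [s' [hs' s's] ->]; rewrite lerN2 leNgt; apply/negP => ms'.
  by apply: h; exists s'.
apply: (@injective_infinite _ (fun n => vec (s 0 0) n%:Z) _ _ _ (fin y)).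
  by move=> i j /(congr1 (fun z : site => z 0 1)); rewrite !vec1 => -[].
move=> n; split=> //; first by rewrite vec0.
move=> u hu; rewrite vec0 => us; rewrite -lerN2 -yl.
by apply: ymax; exists u.
Qed.

(* The regeneration points of a component lying between two deep points of a
   column have a leftmost element: otherwise infinitely many of them would
   cross the finite gap, and one point of this gap would be deep. *)
Lemma reaches_deep z :
    (forall (e : int) y, e != 0 -> finite_set [set z | transport_extreme W f e z y]) ->
    (forall p, finite_set
       [set z | transport_leftmost (stray W f) (regeneration W f) f z p]) ->
    (exists s, deep W f s) -> W z ->
  exists2 s, deep W f s & reaches f z s.
Proof.
move=> fin_ext fin_left [s0 hs0] Wz; apply: contrapT => nz.
pose c := Num.max (z 0 0) (s0 0 0) + 1.
have [|r [hr rc zr]] := regeneration_ahead ws Wz (a := c); first by rewrite /c; lia.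
have [|s1 [hs1 sc1 ss1]] := regeneration_ahead ws (proj1 (proj1 hs0)) (a := c).
  by rewrite /c; lia.
have {hs1 ss1}hs1 := deep_ahead hs0 hs1 ss1.
have br : stray W f r.
  split=> [|s hs rs]; first by case: hr.
  by apply: nz; exists s => //; apply: reaches_trans rs.
(* [s] and [s'] are deep points below and above [r] in its column. *)
have [//||s [hs sc sr]] := @deep_unbounded s1 (-1) (- r 0 1) _ _ hs1.
  by move=> y; apply: fin_ext.
have [//||s' [hs' sc' sr']] := @deep_unbounded s1 1 (r 0 1) _ _ hs1.
  by move=> y; apply: fin_ext.
rewrite mulN1r ltrN2 in sr; rewrite mul1r in sr'.
have {}sc : s 0 0 = r 0 0 by rewrite sc sc1.
have {}sc' : s' 0 0 = r 0 0 by rewrite sc' sc1.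
have [b hb] : exists b : int, forall t, regeneration W f t -> joined f r t -> b <= t 0 0.
  apply: contrapT => nb.
  have [| | |v [hv rv _ _] hQ] := @finite_pigeonhole _ [set v | [/\ regeneration W f v,
      joined f r v, v 0 0 = r 0 0 & s 0 1 <= v 0 1 <= s' 0 1]]
      (fun n v => exists u, [/\ W u, u 0 0 < - n%:Z & reaches f u v]).
  - by apply: (sub_finite_set _ (finite_column (r 0 0) (s 0 1) (s' 0 1))) => v [].
  - by move=> n v [u [Wu un uv]]; exists u; split=> //; lia.
  - move=> n; have [t [ht rt tn]] : exists t, [/\ regeneration W f t, joined f r t &
        t 0 0 < Num.min (- n%:Z) (r 0 0)].
      apply: contrapT => nt; apply: nb; exists (Num.min (- n%:Z) (r 0 0)) => t ht rt.
      by rewrite leNgt; apply/negP => h; apply: nt; exists t.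
    have [|v [hv vr tv]] := regeneration_ahead_le ws ht (a := r 0 0); first by lia.
    have rv := joined_reaches rt tv; have vr' : v 0 0 <= r 0 0 by rewrite vr.
    exists v; last by exists t; split=> //; [case: ht|lia].
    have [h1 _] := joined_regeneration_order hr hv rv vr' (proj1 hs)
      (proj1 hs) (reaches_refl f s) sc (etrans sc (esym vr)) (stray_deep br hs).
    have [_ h2] := joined_regeneration_order hr hv rv vr' (proj1 hs')
      (proj1 hs') (reaches_refl f s') sc' (etrans sc' (esym vr)) (stray_deep br hs').
    by split=> //; rewrite !ltW ?h1 ?h2 ?ltW.
  - apply: (stray_deep br _ rv); split=> // a.
    have [u [Wu ua uv]] := hQ (absz a); exists u; split=> //; lia.
have [|v [hv rv]|d dr|p [hp rp] pmin] :=
    @lexi_min [set t | regeneration W f t /\ joined f r t] r b.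
- by split=> //; apply: joined_refl.
- exact: hb.
(* Being deep, [s] is reached from a regeneration point [y] of column [d], and the component of [r]
   stays above [y] there. *)
- have [u [Wu ud us]] := (proj2 hs) d.
  have [y [hy yd uy]] := regeneration_ahead ws Wu ud.
  have ys : reaches f y s by apply: (regeneration_before (proj1 hs) us uy); rewrite sc yd.
  exists (y 0 1) => v [hv rv] vd.
  have [|h _] := joined_regeneration_order hr hv rv _ (proj1 hs) hy ys sc
    (etrans yd (esym vd)) (stray_deep br hs); first by rewrite vd.
  exact/ltW/h/ltW.
- apply: (no_leftmost _ fin_left (z := r) (p := p)).
    move=> x [Wx hx]; split=> //; split; first exact: (walk_stay ws).
    by move=> y hy fxy; apply: (hx y hy); apply: reaches_trans fxy; exists 1%N.
  by split=> // u hu ru; apply: pmin.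
Qed.

End Transports.

(** * Covariance and measurability *)

(** The configuration seen from the site [x]. The covariance of each transport under this change of
    origin is what the mass transport principle demands. *)
Definition shift_set (x : site) (W : set site) : set site := fun z => W (z + x).

Definition shift_map (x : site) (f : site -> site) (z : site) : site :=
  f (z + x) - x.

Lemma exists_shift (x : site) (Q : site -> Prop) :
  (exists z, Q (z + x)) = (exists z, Q z).
Proof.
apply/propext; split=> [[z hz]|[z hz]]; first by exists (z + x).
by exists (z - x); rewrite subrK.
Qed.

Lemma forall_shift (x : site) (Q : site -> Prop) :
  (forall z, Q (z + x)) = (forall z, Q z).
Proof. by apply/propext; split=> h z //; rewrite -(subrK x z). Qed.

Section Shift.
Variables (x : site) (W : set site) (f : site -> site).
Let W' := shift_set x W.
Let f' := shift_map x f.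

Lemma iter_shift k z : iter k f' z = iter k f (z + x) - x.
Proof.
elim: k => [|k ih] /=; first by rewrite addrK.
by rewrite ih /f' /shift_map subrK.
Qed.

Lemma coord_shift (z : site) (i : 'I_2) : (z + x) 0 i = z 0 i + x 0 i.
Proof. by rewrite mxE. Qed.

Lemma iter_shift_coord k z (i : 'I_2) :
  (iter k f' z) 0 i = (iter k f (z + x)) 0 i - x 0 i.
Proof. by rewrite iter_shift !mxE. Qed.

Lemma iter_shift_eq k z y : (iter k f' z = y) = (iter k f (z + x) = y + x).
Proof.
rewrite iter_shift; apply/propext; split=> [<-|->]; first by rewrite subrK.
by rewrite addrK.
Qed.

Lemma reaches_shift u v : reaches f' u v = reaches f (u + x) (v + x).
Proof.
by apply/propext; split=> -[k h]; exists k; rewrite iter_shift_eq in h *.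
Qed.

Lemma joined_shift u v : joined f' u v = joined f (u + x) (v + x).
Proof.
apply/propext; split=> -[j [k h]]; exists j, k.
  by move: h; rewrite iter_shift_eq iter_shift subrK.
by rewrite iter_shift_eq iter_shift subrK.
Qed.

Lemma regeneration_shift r : regeneration W' f' r = regeneration W f (r + x).
Proof.
apply/propext; split=> -[Wr hr]; split=> // k k0; have := hr k k0.
  by rewrite iter_shift_coord coord_shift; lia.
by rewrite iter_shift_coord coord_shift; lia.
Qed.

Lemma two_sided_shift z : two_sided W' f' z = two_sided W f (z + x).
Proof.
apply/propext; split=> hz n; have [u Wu uz] := hz n.
  by exists (u + x) => //; rewrite -iter_shift_eq.
by exists (u - x); rewrite /W' /shift_set ?iter_shift_eq subrK.
Qed.

Lemma deep_shift r : deep W' f' r = deep W f (r + x).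
Proof.
rewrite /deep regeneration_shift; apply/propext; split=> -[hr hb]; split=> // b.
  have [u [Wu ub ur]] := hb (b - x 0 0); exists (u + x); split=> //.
    by rewrite coord_shift; lia.
  by rewrite -reaches_shift.
have [u [Wu ub ur]] := hb (b + x 0 0); exists (u - x); split=> //.
- by rewrite /W' /shift_set subrK.
- by rewrite !mxE ltrBlDr.
- by rewrite reaches_shift subrK.
Qed.

Lemma stray_shift z : stray W' f' z = stray W f (z + x).
Proof.
rewrite /stray -(forall_shift x (fun s => deep W f s -> _)).
by under eq_forall do rewrite deep_shift reaches_shift.
Qed.

Lemma secondary_shift z : secondary W' f' z = secondary W f (z + x).
Proof.
have sub y : y - f' z = y + x - f (z + x).
  by rewrite /f' /shift_map opprB addrA.
rewrite /secondary two_sided_shift -(exists_shift x (fun z' => [/\ two_sided W f z', _ & _])).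
congr (_ /\ _); apply: eq_exists => y; rewrite two_sided_shift !sub.
have -> // : (f' y = f' z) = (f (y + x) = f (z + x)).
by apply/propext; split=> [/addIr|/(congr1 (fun u => u - x))].
Qed.

Lemma lexi_le_shift u v : lexi_le (u + x) (v + x) = lexi_le u v.
Proof. by apply/propext; rewrite /lexi_le !coord_shift; split; lia. Qed.

Lemma transport_ahead_shift j z r :
  transport_ahead W' f' j z r = transport_ahead W f j (z + x) (r + x).
Proof.
rewrite /transport_ahead regeneration_shift reaches_shift; apply/propext.
by split=> -[? ? ? e]; split=> //; rewrite ?coord_shift; move: e;
  rewrite ?coord_shift; lia.
Qed.

Lemma transport_secondary_shift z n :
  transport_secondary W' f' z n = transport_secondary W f (z + x) (n + x).
Proof.
rewrite /transport_secondary two_sided_shift; congr (_ /\ _).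
apply: eq_exists => k; rewrite iter_shift_eq secondary_shift.
suff -> : (forall i, (i < k)%N -> ~ secondary W' f' (iter i f' z)) =
   (forall i, (i < k)%N -> ~ secondary W f (iter i f (z + x))) by [].
by apply: eq_forall => i; rewrite secondary_shift iter_shift subrK.
Qed.

Lemma transport_leftmost_shift (B E B' E' : set site) z p :
    (forall u, B' u = B (u + x)) -> (forall u, E' u = E (u + x)) ->
  transport_leftmost B' E' f' z p = transport_leftmost B E f (z + x) (p + x).
Proof.
move=> hB hE; rewrite /transport_leftmost hB hE joined_shift.
rewrite -(forall_shift x (fun u => E u -> _)).
suff -> : (forall u, E' u -> joined f' z u -> lexi_le p u) =
  (forall u, E (u + x) -> joined f (z + x) (u + x) -> lexi_le (p + x) (u + x)) by [].
by apply: eq_forall => u; rewrite hE joined_shift lexi_le_shift.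
Qed.

Lemma transport_extreme_shift e z s :
  transport_extreme W' f' e z s = transport_extreme W f e (z + x) (s + x).
Proof.
rewrite /transport_extreme deep_shift -(forall_shift x (fun u => deep W f u -> _)).
have col (u v : site) : (u 0 0 = v 0 0) = ((u + x) 0 0 = (v + x) 0 0).
  by rewrite !coord_shift; apply/propext; split; lia.
rewrite col.
suff -> : (forall u, deep W' f' u -> u 0 0 = z 0 0 -> e * u 0 1 <= e * s 0 1) =
  (forall u, deep W f (u + x) -> (u + x) 0 0 = (z + x) 0 0 ->
    e * (u + x) 0 1 <= e * (s + x) 0 1) by [].
by apply: eq_forall => u; rewrite deep_shift -col !coord_shift !mulrDr lerD2r.
Qed.

End Shift.

Section MeasurablePredicates.
Context {d : measure_display} {Omega : measurableType d}.
Implicit Types Q : Omega -> Prop.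

(** Closure under connectives and countable quantifiers lets measurability follow the syntax of each
    definition. *)
Definition mprop Q : Prop := measurable [set w | Q w].

Lemma mprop_cst (p : Prop) : mprop (fun=> p).
Proof.
rewrite /mprop; have [hp|np] := pselect p.
  by have -> : [set _ : Omega | p] = setT by apply/seteqP; split.
by have -> : [set _ : Omega | p] = set0 by apply/seteqP; split.
Qed.

Lemma mprop_and Q Q' : mprop Q -> mprop Q' -> mprop (fun w => Q w /\ Q' w).
Proof. exact: measurableI. Qed.

Lemma mprop_not Q : mprop Q -> mprop (fun w => ~ Q w).
Proof. exact: measurableC. Qed.

Lemma mprop_ext Q Q' : (forall w, Q w <-> Q' w) -> mprop Q -> mprop Q'.
Proof. by move=> e; congr (measurable _); apply/seteqP; split=> w /e. Qed.

Lemma mprop_imp Q Q' : mprop Q -> mprop Q' -> mprop (fun w => Q w -> Q' w).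
Proof.
move=> mQ mQ'; apply: (@mprop_ext (fun w => ~ (Q w /\ ~ Q' w))).
  move=> w; split=> [h q|h [q nq']]; last exact/nq'/h.
  by apply: contrapT => nq'; apply: h.
exact/mprop_not/mprop_and/mprop_not.
Qed.

Lemma mprop_exists (I : countType) (Q : I -> Omega -> Prop) :
  (forall i, mprop (Q i)) -> mprop (fun w => exists i, Q i w).
Proof.
move=> mQ; apply: (@mprop_ext (fun w => (\bigcup_i [set w | Q i w]) w)).
  by move=> w; split=> [[i _ h]|[i h]]; exists i.
exact: countable_bigcupT_measurable.
Qed.

Lemma mprop_forall (I : countType) (Q : I -> Omega -> Prop) :
  (forall i, mprop (Q i)) -> mprop (fun w => forall i, Q i w).
Proof.
move=> mQ; apply: (@mprop_ext (fun w => ~ exists i, ~ Q i w)).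
  move=> w; split=> [h i|h [i]]; last by apply; apply: h.
  by apply: contrapT => nq; apply: h; exists i.
by apply/mprop_not/mprop_exists => i; apply: mprop_not.
Qed.

Lemma mprop_and3 Q Q' Q'' : mprop Q -> mprop Q' -> mprop Q'' ->
  mprop (fun w => [/\ Q w, Q' w & Q'' w]).
Proof.
move=> h h' h''; apply: mprop_ext (mprop_and h (mprop_and h' h'')) => w.
by split=> [[? []]|[]].
Qed.

Lemma mprop_and4 Q Q' Q'' Q3 : mprop Q -> mprop Q' -> mprop Q'' -> mprop Q3 ->
  mprop (fun w => [/\ Q w, Q' w, Q'' w & Q3 w]).
Proof.
move=> h h' h'' h3; apply: mprop_ext (mprop_and h (mprop_and3 h' h'' h3)) => w.
by split=> [[? []]|[]].
Qed.

Lemma mprop_exists2 (I : countType) (Q Q' : I -> Omega -> Prop) :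
    (forall i, mprop (Q i)) -> (forall i, mprop (Q' i)) ->
  mprop (fun w => exists2 i, Q i w & Q' i w).
Proof.
move=> mQ mQ'.
apply: mprop_ext (mprop_exists (fun i => mprop_and (mQ i) (mQ' i))) => w.
by split=> [[i []]|[i]]; exists i.
Qed.

(** The event splits over the countably many values of [g]. *)
Lemma mprop_subst (I : countType) (g : Omega -> I) (Q : Omega -> I -> Prop) :
    (forall i, mprop (fun w => g w = i)) -> (forall i, mprop (fun w => Q w i)) ->
  mprop (fun w => Q w (g w)).
Proof.
move=> mg mQ.
apply: mprop_ext (mprop_exists (fun i => mprop_and (mg i) (mQ i))) => w.
by split=> [[i [->]]|h] //; exists (g w).
Qed.

End MeasurablePredicates.

Section MeasurableWalks.
Context {d : measure_display} {Omega : measurableType d}.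
Variables (W : Omega -> set site) (f : Omega -> site -> site).
Hypothesis mW : forall z, mprop (fun w => W w z).
Hypothesis mf : forall z y, mprop (fun w => f w z = y).

Lemma mprop_iter k z y : mprop (fun w => iter k (f w) z = y).
Proof.
elim: k y => [|k ih] y; first exact: (mprop_cst (z = y)).
by apply: (mprop_subst (Q := fun w u => f w u = y)) => u; [exact: ih|exact: mf].
Qed.

Lemma mprop_reaches u v : mprop (fun w => reaches (f w) u v).
Proof. by apply: mprop_exists => k; apply: mprop_iter. Qed.

Lemma mprop_joined u v : mprop (fun w => joined (f w) u v).
Proof.
apply: mprop_exists => j; apply: mprop_exists => k.
apply: (mprop_subst (Q := fun w y => iter j (f w) u = y)) => y; exact: mprop_iter.
Qed.

Lemma mprop_regeneration r : mprop (fun w => regeneration (W w) (f w) r).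
Proof.
apply: mprop_and => //; apply: mprop_forall => k; apply: mprop_imp; first exact: mprop_cst.
apply: (mprop_subst (g := fun w => iter k (f w) r) 
  (Q := fun _ y => is_true (r 0 0 < y 0 0))) => y; first exact: mprop_iter.
exact: mprop_cst.
Qed.

Lemma mprop_two_sided z : mprop (fun w => two_sided (W w) (f w) z).
Proof.
by apply: mprop_forall => n; apply: mprop_exists2 => u //; apply: mprop_iter.
Qed.

Lemma mprop_deep r : mprop (fun w => deep (W w) (f w) r).
Proof.
apply: mprop_and; first exact: mprop_regeneration.
apply: mprop_forall => b; apply: mprop_exists => u.
by apply: mprop_and3 => //; [exact: mprop_cst|exact: mprop_reaches].
Qed.

Lemma mprop_stray z : mprop (fun w => stray (W w) (f w) z).
Proof.
apply: mprop_and => //; apply: mprop_forall => s.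
by apply: mprop_imp; [exact: mprop_deep|exact/mprop_not/mprop_reaches].
Qed.

Lemma mprop_secondary z : mprop (fun w => secondary (W w) (f w) z).
Proof.
apply: mprop_and; first exact: mprop_two_sided.
apply: mprop_exists => y; apply: mprop_and3; first exact: mprop_two_sided.
  by apply: (mprop_subst (Q := fun w u => f w y = u)).
apply: (mprop_subst (g := fun w => f w z)
  (Q := fun _ u => is_true (pickle (y - u)%R < pickle (z - u)%R)%N)) => // u.
exact: mprop_cst.
Qed.

Lemma mprop_transport_ahead j z r : mprop (fun w => transport_ahead (W w) (f w) j z r).
Proof.
by apply: mprop_and4 => //;
  [exact: mprop_regeneration|exact: mprop_reaches|exact: mprop_cst].
Qed.

Lemma mprop_transport_secondary z n :
  mprop (fun w => transport_secondary (W w) (f w) z n).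
Proof.
apply: mprop_and; first exact: mprop_two_sided.
apply: mprop_exists => k; apply: mprop_and3; first exact: mprop_iter.
  exact: mprop_secondary.
apply: mprop_forall => i; apply: mprop_imp; first exact: mprop_cst.
apply: (mprop_subst (Q := fun w u => ~ secondary (W w) (f w) u)) => u.
  exact: mprop_iter.
exact/mprop_not/mprop_secondary.
Qed.

Lemma mprop_transport_leftmost (B E : Omega -> set site) z p :
    (forall u, mprop (fun w => B w u)) -> (forall u, mprop (fun w => E w u)) ->
  mprop (fun w => transport_leftmost (B w) (E w) (f w) z p).
Proof.
move=> mB mE; apply: mprop_and4 => //; first exact: mprop_joined.
apply: mprop_forall => u; apply: mprop_imp => //; apply: mprop_imp.
  exact: mprop_joined.
exact: mprop_cst.
Qed.

Lemma mprop_transport_extreme e z s :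
  mprop (fun w => transport_extreme (W w) (f w) e z s).
Proof.
apply: mprop_and3; [exact: mprop_deep|exact: mprop_cst|].
apply: mprop_forall => u; apply: mprop_imp; first exact: mprop_deep.
exact: mprop_cst.
Qed.

End MeasurableWalks.

(** * Mass transport *)

Section MassTransport.
Context {d : measure_display} {Omega : measurableType d} {R : realType}.
Variables (P : probability Omega R).

Lemma ae_forall_countable (I : countType) (Q : I -> Omega -> Prop) :
  (forall i, {ae P, forall w, Q i w}) -> {ae P, forall w, forall i, Q i w}.
Proof.
move=> aeQ.
have : P.-negligible (\bigcup_n (if (unpickle n : option I) is Some i
    then ~` [set w | Q i w] else set0)).
  apply: negligible_bigcup => n; case: unpickle => [i|]; first exact: aeQ.
  exact: negligible_set0.
apply: negligibleS => w /= nQ; apply: contrapT => h; apply: nQ => i.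
by apply: contrapT => nQi; apply: h; exists (pickle i) => //; rewrite pickleK.
Qed.

Variables (n : nat) (T : 'rV[int]_n -> Omega -> Omega).
Hypothesis hT : mp_action P T.

Lemma invariant_full_set (Q : Omega -> Prop) : {ae P, forall w, Q w} ->
  exists G : set Omega, [/\ measurable G, {ae P, forall w, G w},
    forall x w, G (T x w) = G w & forall w, G w -> Q w].
Proof.
have [T0 Tadd Tmeas TP] := hT.
(* Discarding all translates of [N], countably many null sets, leaves an invariant set of full
   measure. *)
move=> [N [mN PN QN]]; exists [set w | forall x, ~ N (T x w)].
have mNx x : measurable (T x @^-1` N).
  by rewrite -[X in measurable X]setTI; apply: Tmeas.
split.
- apply: (@mprop_forall _ _ 'rV[int]_n (fun x w => ~ N (T x w))) => x.
  exact: (measurableC (mNx x)).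
- apply: ae_forall_countable => x; exists (T x @^-1` N); split=> //.
    by rewrite TP.
  by move=> w /= /contrapT.
- move=> x w; apply/propext; split=> h y; last by rewrite -Tadd.
  by rewrite -(subrK x y) Tadd.
- by move=> w /(_ 0); rewrite T0 => nN; apply: contrapT => nQ; apply/nN/QN.
Qed.

(* [S w z y] says that [z] sends mass to [y]: the expected mass received by
   [y] equals the expected mass sent by [y], which is at most 1. *)
Lemma mass_transport (S : Omega -> 'rV[int]_n -> 'rV[int]_n -> Prop) :
    (forall z y, mprop (fun w => S w z y)) ->
    (forall x w z y, S (T x w) z y = S w (z + x) (y + x)) ->
    (forall w z y y', S w z y -> S w z y' -> y = y') ->
  {ae P, forall w, forall y, finite_set [set z | S w z y]}.
Proof.
have [_ _ _ TP] := hT.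
move=> mS Scov Sfun; apply: ae_forall_countable => y.
pose F (k : nat) := if (pickle_inv k : option 'rV[int]_n) is Some z
  then [set w | S w z y] else set0.
(* Translating by [y - z] turns the event that [z] sends to [y] into the event that [y] sends to
   [y + y - z]. For distinct [z] the latter are disjoint, so their probabilities add up to at most
   1. *)
pose G (k : nat) := if (pickle_inv k : option 'rV[int]_n) is Some z
  then [set w | S w y (y + y - z)] else set0.
have mF k : measurable (F k) by rewrite /F; case: pickle_inv => // z; apply: mS.
have mG k : measurable (G k) by rewrite /G; case: pickle_inv => // z; apply: mS.
have FG k : P (F k) = P (G k).
  rewrite /F /G; case: pickle_inv => // z.
  rewrite -(TP (y - z)); last exact: mS.
  congr (P _); apply/seteqP; split=> w /=;
    by rewrite Scov addrCA subrr addr0 addrA.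
have Gdisj : trivIset setT G.
  move=> i j _ _ [w []]; rewrite /G.
  have := @pickle_invK 'rV[int]_n i; have := @pickle_invK 'rV[int]_n j.
  case: (pickle_inv i) => //= z; case: (pickle_inv j) => //= z' <- <- h h'.
  by have /addrI/oppr_inj -> := Sfun _ _ _ _ h h'.
(* Borel-Cantelli: outside this null set the codes of the senders to [y] are bounded. *)
exists (lim_sup_set F); split.
- apply: bigcapT_measurable => k; exact: bigcup_measurable.
- apply: lim_sup_set_cvg0 => //.
  rewrite (eq_eseriesr (g := fun k => P (G k))); last by move=> k _; exact: FG.
  rewrite -measure_semi_bigcup //; last exact: bigcupT_measurable.
  by rewrite (le_lt_trans (probability_le1 P _)) ?ltry //; apply: bigcupT_measurable.
- move=> w /= inf k _; apply: contrapT => h; apply: inf.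
  apply: (@sub_finite_set _ _ (pickle @^-1` `I_k)).
    move=> z /= Sz; rewrite ltnNge; apply/negP => kz; apply: h.
    by exists (pickle z) => //; rewrite /F pickleK_inv.
  apply: finite_preimage; last exact: finite_II.
  by move=> a b _ _; apply: (pcan_inj pickleK).
Qed.

End MassTransport.

(** * Almost sure coalescence *)

Lemma nearest_neighbor_adjacent (p : nat -> site) k :
  nearest_neighbor_path p -> adjacent (p k) (p k.+1).
Proof.
move=> /(_ k); rewrite !big_ord_recl big_ord0 addr0 /adjacent => <-.
by congr (_ + `|p _ 0 _ - p _ 0 _|); apply: val_inj.
Qed.

(** Membership in [W] is repeated beside the value of [X] because [measurable_walks] provides
    exactly such joint events. *)
Definition backward_chain (W : set site) (X : site -> nat -> site) (z : site)
    (s : seq site) : Prop :=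
  forall m : nat, (m < size s)%N -> [/\ W (nth 0 s m), nth 0 s 0 = z &
    forall i : nat, (1 <= m)%N -> (i <= m)%N ->
      W (nth 0 s m) /\ X (nth 0 s m) i = nth 0 s (m - i)].

(** Koenig's lemma applies: the first term is [z], and each later term is a neighbour of the one
    before it. *)
Lemma bi_infinite_point_chains (W : set site) (X : site -> nat -> site) (z : site) :
    (forall y, W y -> X y 0%N = y /\ nearest_neighbor_path (X y)) ->
  bi_infinite_point W X z <->
  forall n, exists s, size s = n /\ backward_chain W X z s.
Proof.
move=> nn; split=> [[a [Wa a0 aX]] n|chains].
  exists (mkseq a n); rewrite size_mkseq; split=> // m; rewrite size_mkseq => mn.
  rewrite !nth_mkseq //; last by case: n mn.
  split=> // i m1 im; rewrite nth_mkseq; last by lia.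
  by split=> //; apply: aX.
have [||n|a ha] := @konig _ (backward_chain W X z).
- move=> s x h m ms; have := h m; rewrite size_rcons => /(_ (ltnW ms)).
  rewrite !nth_rcons ms (leq_ltn_trans _ ms) // => -[Wm s0 hX]; split=> // i m1 im.
  by have := hX i m1 im; rewrite nth_rcons (leq_ltn_trans (leq_subr _ _) ms).
- move=> s; case: (lastP s) => [|s' y].
    apply: sub_finite_set (finite_set1 z) => x /(_ 0%N isT)[_ /= ->] //.
  apply: (sub_finite_set _ (finite_adjacent y)) => x /= h.
  have := h (size s').+1; rewrite !size_rcons ltnSn => /(_ isT)[].
  rewrite !nth_rcons !size_rcons ltnn eqxx => Wx _ /(_ 1%N isT isT)[_].
  rewrite subn1 /= nth_rcons size_rcons ltnSn nth_rcons ltnn eqxx => <-.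
  by have [x0 hx] := nn x Wx; rewrite -{1}x0; apply: nearest_neighbor_adjacent.
- by have [s []] := chains n; exists s.
exists a; split=> [m||m i m1 im].
- by have := ha m.+1 m; rewrite size_mkseq ltnSn nth_mkseq // => /(_ isT)[].
- by have := ha 1%N 0%N isT => -[].
have := ha m.+1 m; rewrite size_mkseq ltnSn => /(_ isT)[_ _ /(_ i m1 im)[_]].
by rewrite !nth_mkseq //; lia.
Qed.

Lemma two_sided_bi_infinite (W : set site) (f : site -> site)
    (X : site -> nat -> site) (z : site) :
    walk_system W f -> (forall y k, W y -> X y k = iter k f y) ->
  two_sided W f z -> bi_infinite_point W X z.
Proof.
move=> ws Xf hz.
have /choice[g hg] y : exists x, two_sided W f y -> two_sided W f x /\ f x = y.
  have [hy|] := pselect (two_sided W f y); last by exists 0.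
  by have [x hx fx] := two_sided_preimage ws hy; exists x.
have hb i : two_sided W f (iter i g z).
  by elim: i => // i ih; case: (hg _ ih).
exists (fun i => iter i g z); split=> [m||m i _ im] //.
  exact: two_sided_mem (hb m).
rewrite Xf; last exact: two_sided_mem (hb m).
rewrite -{1}(subnKC im); move: (m - i)%N => j {im}.
elim: i => // i ih; rewrite iterSr addSn iterS.
by have [_ ->] := hg _ (hb (i + j)%N).
Qed.

Lemma bi_infinite_two_sided (W : set site) (f : site -> site)
    (X : site -> nat -> site) (z : site) :
    (forall y k, W y -> X y k = iter k f y) ->
  bi_infinite_point W X z -> two_sided W f z.
Proof.
move=> Xf [a [Wa a0 aX]] n; exists (a n) => //; rewrite -Xf //.
case: n => [|n]; first by rewrite Xf.
by rewrite aX // subnn.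
Qed.

(* [P] is unspecified on non-measurable sets, so this must hold for the original
   walks, on null sets included; Koenig's lemma replaces the uncountable
   quantifier over backward sequences by countable ones. *)
Lemma measurable_bi_infinite (d : measure_display) (Omega : measurableType d)
    (W : Omega -> set site) (X : Omega -> site -> nat -> site) :
    measurable_random_set W -> nearest_neighbor_walks W X -> measurable_walks W X ->
  measurable [set w | exists S, bi_infinite_trajectory (W w) (X w) S].
Proof.
move=> mW nn mX.
apply: (@mprop_ext _ _ (fun w => exists z : site, forall n : nat, exists s : seq site,
    size s = n /\ backward_chain (W w) (X w) z s)).
  move=> w; split=> [[z /(bi_infinite_point_chains z (nn w))[a ha]]|[S [z [a [ha _]]]]].
    by eexists; exists z, a; split; [exact: ha|reflexivity].
  by exists z; apply/(bi_infinite_point_chains z (nn w)); exists a.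
apply: mprop_exists => z; apply: mprop_forall => n; apply: mprop_exists => s.
apply: mprop_and; first exact: mprop_cst.
apply: mprop_forall => m; apply: mprop_imp; first exact: mprop_cst.
apply: mprop_and3; [exact: mW|exact: mprop_cst|].
apply: mprop_forall => i; apply: mprop_imp; first exact: mprop_cst.
apply: mprop_imp; first exact: mprop_cst.
exact: mX.
Qed.

Section AlmostSure.
Context {d : measure_display} {Omega : measurableType d} {R : realType}.
Variables (P : probability Omega R) (T : site -> Omega -> Omega).
Variables (W : Omega -> set site) (f : Omega -> site -> site).
Hypothesis hT : mp_action P T.
Hypothesis ws : forall w, walk_system (W w) (f w).
Hypothesis mW : forall z, mprop (fun w => W w z).
Hypothesis mf : forall z y, mprop (fun w => f w z = y).
Hypothesis W_shift : forall x w, W (T x w) = shift_set x (W w).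
Hypothesis f_shift : forall x w, f (T x w) = shift_map x (f w).

Lemma ae_finite_ahead : {ae P, forall w, forall j r,
  finite_set [set z | transport_ahead (W w) (f w) j z r]}.
Proof.
apply: ae_forall_countable => j; apply: (mass_transport hT).
- by move=> z y; apply: mprop_transport_ahead.
- by move=> x w z y; rewrite W_shift f_shift transport_ahead_shift.
- by move=> w z y y'; apply: transport_ahead_functional.
Qed.

Lemma ae_finite_secondary : {ae P, forall w, forall n,
  finite_set [set z | transport_secondary (W w) (f w) z n]}.
Proof.
apply: (mass_transport hT).
- by move=> z y; apply: mprop_transport_secondary.
- by move=> x w z y; rewrite W_shift f_shift transport_secondary_shift.
- by move=> w z y y'; apply: transport_secondary_functional.
Qed.

Lemma ae_finite_two_sided : {ae P, forall w, forall p, finite_set [set z |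
  transport_leftmost (two_sided (W w) (f w)) (two_sided (W w) (f w)) (f w) z p]}.
Proof.
apply: (mass_transport hT).
- by move=> z y; apply: mprop_transport_leftmost => // u; apply: mprop_two_sided.
- move=> x w z y; rewrite W_shift f_shift; apply: transport_leftmost_shift => u;
    exact: two_sided_shift.
- by move=> w z y y'; apply: transport_leftmost_functional.
Qed.

Lemma ae_finite_stray : {ae P, forall w, forall p, finite_set [set z |
  transport_leftmost (stray (W w) (f w)) (regeneration (W w) (f w)) (f w) z p]}.
Proof.
apply: (mass_transport hT).
- move=> z y; apply: mprop_transport_leftmost => // u; first exact: mprop_stray.
  exact: mprop_regeneration.
- move=> x w z y; rewrite W_shift f_shift; apply: transport_leftmost_shift => u.
    exact: stray_shift.
  exact: regeneration_shift.
- by move=> w z y y'; apply: transport_leftmost_functional.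
Qed.

Lemma ae_finite_extreme : {ae P, forall w, forall (e : int) y, e != 0 ->
  finite_set [set z | transport_extreme (W w) (f w) e z y]}.
Proof.
apply: ae_forall_countable => e; have [e0|e0] := eqVneq e 0.
  exact: aeW.
have : {ae P, forall w, forall y,
    finite_set [set z | transport_extreme (W w) (f w) e z y]}.
  apply: (mass_transport hT).
  - by move=> z y; apply: mprop_transport_extreme.
  - by move=> x w z y; rewrite W_shift f_shift transport_extreme_shift.
  - by move=> w z y y'; apply: transport_extreme_functional.
by apply: filterS => w h y _; apply: h.
Qed.

Lemma ae_two_sided_deep : {ae P, forall w,
  (exists z, two_sided (W w) (f w) z) -> exists s, deep (W w) (f w) s}.
Proof.
move: ae_finite_ahead ae_finite_secondary ae_finite_two_sided.
apply: filterS3 => w h1 h2 h3 [z hz].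
have [|r [hr _ [k zr]]] := regeneration_ahead (ws w) (two_sided_mem hz) (a := z 0 0 + 1).
  by lia.
exists r; apply: two_sided_deep => //.
by rewrite -zr; apply: two_sided_iter.
Qed.

Lemma ae_reaches_deep : {ae P, forall w, (exists s, deep (W w) (f w) s) ->
  forall z, W w z -> exists2 s, deep (W w) (f w) s & reaches (f w) z s}.
Proof.
move: ae_finite_extreme ae_finite_stray.
by apply: filterS2 => w h1 h2 hs z; apply: reaches_deep.
Qed.

(** The existence of a deep point is invariant under every [T x], so its probability is 0 or 1. *)
Lemma ae_exists_deep : ergodic_action P T ->
    ~ {ae P, forall w, ~ exists s, deep (W w) (f w) s} ->
  {ae P, forall w, exists s, deep (W w) (f w) s}.
Proof.
move=> erg npos; pose D := [set w | exists s, deep (W w) (f w) s].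
have mD : measurable D by apply: mprop_exists => s; apply: mprop_deep.
have [|PD|PD] := erg D mD.
- move=> x; apply/seteqP; split=> w; rewrite /D /= W_shift f_shift.
    by move=> [s]; rewrite deep_shift => hs; exists (s + x).
  by move=> [s hs]; exists (s - x); rewrite deep_shift subrK.
- case: npos; exists D; split=> // w /= h; exact: contrapT.
- exists (~` D); split=> //; first exact: measurableC.
  by rewrite probability_setC // PD subee.
Qed.

End AlmostSure.

(** Off [W] the values of [X] are arbitrary; the identity there gives a total map that is still
    measurable and covariant. *)
Definition step (W : set site) (X : site -> nat -> site) (z : site) : site :=
  if `[< W z >] then X z 1%N else z.

Lemma iter_step (W : set site) (X : site -> nat -> site) (z : site) (k : nat) :
    (forall y, W y -> X y 0%N = y) ->
    (forall y, W y -> W (X y 1%N) /\ forall k, X y k.+1 = X (X y 1%N) k) ->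
  W z -> X z k = iter k (step W X) z.
Proof.
move=> X0 comp; elim: k z => [|k ih] z Wz; first exact: X0.
have [Wz1 ->] := comp z Wz; rewrite ih // iterSr.
by rewrite [in RHS]/step asboolT.
Qed.

Lemma walk_system_step (W : set site) (X : site -> nat -> site) :
    (forall z, W z -> X z 0%N = z /\ nearest_neighbor_path (X z)) ->
    (forall z, W z -> W (X z 1%N) /\ forall k, X z k.+1 = X (X z 1%N) k) ->
    (forall z, W z -> no_loops (X z)) ->
    (forall z, W z -> forall a : int, z 0 0 < a -> eventually_right_of (X z) a) ->
  walk_system W (step W X).
Proof.
move=> nn comp loops right.
have Xf z : W z -> X z = fun k => iter k (step W X) z.
  by move=> Wz; apply/funext => k; apply: iter_step => // y /nn[].
split=> [z Wz|z Wz|z i j Wz e|z a Wz za].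
- by rewrite /step asboolT //; case: (comp z Wz).
- rewrite /step asboolT //; have [z0 hz] := nn z Wz.
  by have := nearest_neighbor_adjacent 0%N hz; rewrite z0.
- apply: contrapT => ij; apply: (loops z Wz i j ij).
  by rewrite Xf.
- by rewrite -Xf //; apply: right.
Qed.

Unset Implicit Arguments.

Theorem corollary2p7 (d : measure_display) (Omega : measurableType d)
    (R : realType) (P : probability Omega R)
    (T : 'rV[int]_2 -> Omega -> Omega)
    (W : Omega -> set 'rV[int]_2)
    (X : Omega -> 'rV[int]_2 -> nat -> 'rV[int]_2)
    (hT : mp_action P T)
    (hWmeas : measurable_random_set W)
    (hWcov : translation_covariant T W)
    (hWpos : (0 < P [set w | W w 0%R])%E)
    (hXnn : nearest_neighbor_walks W X)
    (hXmeas : measurable_walks W X)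
    (hXstat : {ae P, forall w, stationary_at T W X w})
    (hXcomp : {ae P, forall w, compatible_at W X w})
    (hErg : ergodic_action P T)
    (hLoops : {ae P, forall w, forall z, W w z -> no_loops (X w z)})
    (hRight : {ae P, forall w, forall z, W w z ->
       forall a : int, z 0 0 < a -> eventually_right_of (X w z) a})
    (hBi : (0 < P [set w | exists S, bi_infinite_trajectory (W w) (X w) S])%E) :
  {ae P, forall w, forall z, W w z ->
     exists k : nat, bi_infinite_point (W w) (X w) (X w z k)}.
Proof.
have aeQ : {ae P, forall w, [/\ stationary_at T W X w, compatible_at W X w,
    forall z, W w z -> no_loops (X w z) &
    forall z, W w z -> forall a : int, z 0 0 < a -> eventually_right_of (X w z) a]}.
  apply: filter_app hRight; move: hXstat hXcomp hLoops.
  by apply: filterS3 => w h1 h2 h3 h4; split.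
have [G [mG aeG GT GQ]] := invariant_full_set hT aeQ.
(* Emptying W outside the invariant set G makes the almost sure hypotheses hold
   for every w. *)
pose V w : set site := fun z => G w /\ W w z.
pose f w := step (V w) (X w).
have Vnn w z : V w z -> X w z 0%N = z /\ nearest_neighbor_path (X w z).
  by move=> [_]; apply: hXnn.
have Vcomp w z : V w z -> V w (X w z 1%N) /\ forall k, X w z k.+1 = X w (X w z 1%N) k.
  by move=> [Gw Wz]; have [_ /(_ z Wz)[Wz1 Xz] _ _] := GQ w Gw.
have Xf w z k : V w z -> X w z k = iter k (f w) z.
  by apply: iter_step => [y /Vnn[]|y /Vcomp].
have ws w : walk_system (V w) (f w).
  apply: walk_system_step => [||z [Gw Wz]|z [Gw Wz]].
  - exact: Vnn.
  - exact: Vcomp.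
  - by have [_ _ loops _] := GQ w Gw; apply: loops.
  - by have [_ _ _ right] := GQ w Gw; apply: right.
have mV z : mprop (fun w => V w z) by apply: mprop_and => //; apply: hWmeas.
have mf z y : mprop (fun w => f w z = y).
  apply: (@mprop_ext _ _ (fun w => (G w /\ (W w z /\ X w z 1%N = y)) \/ ~ V w z /\ z = y)).
    move=> w; rewrite /f /step; case: asboolP => [[Gw Wz]|nV].
      split=> [[[_ []]|[nV _]]|e] //; last by left.
      by case: nV.
    split=> [[[Gw [Wz _]]|[]]|e] //; last by right.
    by case: nV.
  apply: measurableU; first by apply: mprop_and => //; apply: hXmeas.
  by apply: mprop_and; [apply: mprop_not|apply: mprop_cst].
have V_shift x w : V (T x w) = shift_set x (V w).
  apply/funext => z; rewrite /V /shift_set GT hWcov; apply/propext.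
  split=> -[Gw]; first by move=> [y Wy <-]; rewrite subrK.
  by move=> Wz; split=> //; exists (z + x) => //; rewrite addrK.
have f_shift x w : f (T x w) = shift_map x (f w).
  apply/funext => z; rewrite /f /shift_map /step V_shift /shift_set.
  case: asboolP => [[Gw Wz]|_]; last by rewrite addrK.
  have [stat _ _ _] := GQ w Gw.
  by rewrite (stat _ x 1%N Wz) addrK addrAC subrr add0r.
have aeE := ae_two_sided_deep hT ws mV mf V_shift f_shift.
have aeR := ae_reaches_deep hT ws mV mf V_shift f_shift.
(* Without deep points there would almost surely be no two-sided point, hence no bi-infinite
   trajectory, against [hBi]. *)
have aeD : {ae P, forall w, exists s, deep (V w) (f w) s}.
  apply: (ae_exists_deep mV mf V_shift f_shift hErg) => nD.
  suff : P [set w | exists S, bi_infinite_trajectory (W w) (X w) S] = 0%E.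
    by move=> e; move: hBi; rewrite e ltxx.
  apply/negligibleP; first exact: measurable_bi_infinite.
  suff : {ae P, forall w, ~ exists S, bi_infinite_trajectory (W w) (X w) S}.
    by apply: negligibleS => w hw; apply.
  move: aeG nD aeE; apply: filterS3 => w Gw nd ed [S [z [a [ha _]]]]; apply/nd/ed.
  exists z; apply: (@bi_infinite_two_sided _ _ (X w)); first by move=> y k; apply: Xf.
  by exists a; case: ha => Wa a0 aX; split.
move: aeG aeD aeR; apply: filterS3 => w Gw ed er z Wz.
have Vz : V w z by [].
(* The deep point reached is two-sided, hence bi-infinite. *)
have [s hs [k zs]] := er ed z Vz; exists k; rewrite Xf // zs.
have [a [Va a0 aX]] := two_sided_bi_infinite (ws w) (fun y k => Xf w y k)
  (deep_two_sided (ws w) hs).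
by exists a; split=> // m; case: (Va m).
Qed.
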